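(* Let $\alpha\in\mathbb{R}$ with $0<\alpha<1$, and let $\{P_m(z)\}_{m=0}^{\infty}$ be the sequence of polynomials generated by $$\sum_{m=0}^{\infty}P_m(z)t^m=\frac{1}{(1-t)^{\alpha}(1-2zt+t^2)}.$$ Then there is a constant $C$ (independent of $m$) such that for all $m\in\mathbb{N}$ the number of zeros of $P_m(z)$ outside the interval $(-1,1)$ (i.e. in $\mathbb{C}\setminus(-1,1)$), counted with multiplicity, is at most $C$.
   Context: The generating function identity is the expansion as a power series in $t$ around $t=0$, with the principal branch of $(1-t)^{\alpha}$ (equal to $1$ at $t=0$). Each $P_m$ is a polynomial in $z$ of degree $m$; equivalently $P_m(z)=\sum_{k=0}^{m}\binom{\alpha+m-k-1}{m-k}U_k(z)$, where $U_k$ are the Chebyshev polynomials of the second kind, defined by $\sum_{k\ge 0}U_k(z)t^k=\frac{1}{1-2tz+t^2}$, and the generalized binomial coefficient is $\binom{\alpha+j-1}{j}=\frac{\alpha(\alpha+1)\cdots(\alpha+j-1)}{j!}$. The constant $C$ may depend on $\alpha$. *)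

(* Defs.v *)
From HB Require Import structures.
From mathcomp Require Import all_boot all_order all_algebra.
From mathcomp Require Import complex.
From mathcomp Require Import all_classical all_reals all_analysis.

Set Implicit Arguments.
Unset Strict Implicit.
Unset Printing Implicit Defensive.

Import Order.TTheory GRing.Theory Num.Theory.
Import numFieldNormedType.Exports.

Local Open Scope classical_set_scope.
Local Open Scope ring_scope.
Local Open Scope complex_scope.

Section Defs.
Variable R : realType.
Implicit Types (w z : R[i]) (p : {poly R[i]}).

Definition cmod w : R := Num.sqrt (complex.Re w ^+ 2 + complex.Im w ^+ 2).

(* Principal argument, in ]-pi, pi]; the value at 0 is irrelevant. *)
Definition carg w : R :=
  if 0 <= complex.Im w then acos (complex.Re w / cmod w)
  else - acos (complex.Re w / cmod w).

(* Principal branch exp (a * (ln |w| + i * carg w)) of w ^ a, for w != 0. *)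
Definition cpow w (a : R) : R[i] :=
  (cmod w `^ a)%:C * (cos (a * carg w) +i* sin (a * carg w)).

(* The identity holds as a convergent power series in the complex variable t
   around 0; the radius of convergence may depend on z. The alias R[i]^o carries
   the topology of the norm of R[i]. *)
Definition generated_by (P : nat -> {poly R[i]}) (a : R) : Prop :=
  forall z : R[i], \forall t \near (0 : R[i]^o),
    series (fun m => (P m).[z] * t ^+ m : R[i]^o) @ \oo -->
      (1 / (cpow (1 - t) a * (1 - 2 * z * t + t ^+ 2)) : R[i]^o).

Definition real_interval (a b : R) : set R[i] :=
  [set x%:C | x in [set x : R | a < x < b]].

(* The zero polynomial has infinitely many zeros, whereas mup x 0 = 0, hence the
   first conjunct. For p != 0 the sum has finite support. *)
Definition at_most_zeros_in (D : set R[i]) p (n : nat) : Prop :=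
  p != 0 /\ (\sum_(x \in D) mup x p <= n)%N.

End Defs.

(* Main.v *)
Require Import Defs.
From HB Require Import structures.
From mathcomp Require Import all_boot all_order all_algebra.
From mathcomp Require Import complex.
From mathcomp Require Import all_classical all_reals all_analysis.
From mathcomp Require Import polyrcf ring lra.

(** In fact every zero of [P m] lies in ]-1, 1[, so that the constant 0 works.

    Write a_j = alpha (alpha + 1) ... (alpha + j - 1) / j! for the coefficients
    of (1 - t)^(-alpha). Expanding the generating function gives
    P_m = sum_(j <= m) a_j U_(m - j), with U_k the Chebyshev polynomials of the
    second kind. Since sin u * U_k (cos u) = sin ((k + 1) u), multiplication by
    2 sin (u / 2) sin u turns P_m (cos u) into
      sum_(j <= m) a_j (cos (w - (j + 1) u) - cos (w - j u)),
      where w = (m + 3/2) u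
    ([genpoly_trig]). When w = k pi this is
    (-1)^(k + 1) sum_(j <= m) a_j (e_(j + 1) - e_j) with e_j = 1 - cos (j u) >= 0
    and e_0 = 0. Because 0 < alpha < 1, the a_j are positive and decreasing, so
    a summation by parts shows that the last sum is positive ([abel_sum_gt0]).
    Hence P_m alternates in sign at the m + 1 points cos (k pi / (m + 3/2)),
    1 <= k <= m + 1, of ]-1, 1[ ([genpoly_sign]). It therefore has m distinct
    zeros there, and its degree leaves no room for others ([genpoly_roots]).

    Only the expansion of the generating function needs analysis. Restricting
    to real z and small real t > 0, where the principal power is the real one,
    and taking real and imaginary parts, reduces it to real power series. There
    the identity follows from the binomial series ([binomial_series]), obtained
    by bounding the remainder with the mean value theorem, and from the
    uniqueness of the coefficients of a power series ([pseries0_coef]). Two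
    polynomials that agree at all real points are equal, which recovers P_m. *)

Set Implicit Arguments.
Unset Strict Implicit.
Unset Printing Implicit Defensive.

Import Order.TTheory GRing.Theory Num.Theory.
Import numFieldNormedType.Exports.

Local Open Scope classical_set_scope.
Local Open Scope ring_scope.

(** * Coefficients of the binomial series *)

Section Coefficients.
Variables (R : realType) (alpha : R).
Hypotheses (alpha_gt0 : 0 < alpha) (alpha_lt1 : alpha < 1).

(** The generalized binomial coefficient 'C(alpha + j - 1, j), that is the
    coefficient of t^j in (1 - t)^(-alpha). *)
Definition binom_coef (j : nat) : R :=
  \prod_(i < j) ((alpha + i%:R) / i.+1%:R).

Lemma binom_coef0 : binom_coef 0 = 1.
Proof. by rewrite /binom_coef big_ord0. Qed.

Lemma binom_coefS j : j.+1%:R * binom_coef j.+1 = (alpha + j%:R) * binom_coef j.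
Proof.
rewrite /binom_coef big_ord_recr /= mulrCA mulrC; congr (_ * _).
by rewrite mulrC divfK ?pnatr_eq0.
Qed.

Lemma binom_coef_gt0 j : 0 < binom_coef j.
Proof.
by apply: prodr_gt0 => i _; rewrite divr_gt0 ?ltr0n// ltr_wpDr.
Qed.

Lemma binom_coef_decr j : binom_coef j.+1 < binom_coef j.
Proof.
rewrite -(ltr_pM2l (ltr0Sn R j)) binom_coefS ltr_pM2r ?binom_coef_gt0//.
by rewrite -natr1 addrC ltrD2l.
Qed.

Lemma binom_coef_le1 j : binom_coef j <= 1.
Proof.
elim: j => [|j IH]; first by rewrite binom_coef0.
exact: le_trans (ltW (binom_coef_decr j)) IH.
Qed.

End Coefficients.

(** * Summation by parts *)

Section AbelSummation.
Variables (R : realDomainType) (a e : nat -> R).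
Hypotheses (a_gt0 : forall j, 0 < a j) (a_decr : forall j, a j.+1 < a j).
Hypotheses (e0 : e 0%N = 0) (e1_gt0 : 0 < e 1%N) (e_ge0 : forall j, 0 <= e j).

(** Moving the differences from [e] to [a] leaves the boundary term
    a_m e_(m + 1) plus the sum over 1 <= j <= m of the nonnegative
    (a_(j - 1) - a_j) e_j. Strictness comes from the term j = 1, or from the
    boundary term if m = 0. *)
Lemma abel_sum_gt0 m : 0 < \sum_(j < m.+1) a j * (e j.+1 - e j).
Proof.
have H n : a n.+1 * e n.+2 < \sum_(j < n.+2) a j * (e j.+1 - e j).
  elim: n => [|n IH].
    rewrite !big_ord_recr big_ord0 /= e0.
    have := mulr_gt0 _ e1_gt0; move=> /(_ (a 0%N - a 1%N)).
    rewrite subr_gt0 => /(_ (a_decr 0)); lra.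
  rewrite big_ord_recr /=.
  have : 0 <= (a n.+1 - a n.+2) * e n.+2.
    by rewrite mulr_ge0 ?e_ge0// subr_ge0 ltW ?a_decr.
  lra.
case: m => [|n]; last by apply: le_lt_trans (H n); apply: mulr_ge0; rewrite ?e_ge0// ltW.
by rewrite big_ord1 e0 subr0 mulr_gt0.
Qed.

End AbelSummation.

(** * Chebyshev expansion and signs at the sample points *)

Section Polynomials.
Variables (R : realType) (alpha : R).

(** Chebyshev polynomials of the second kind. *)
Fixpoint chebU (n : nat) : {poly R} :=
  match n with
  | 0 => 1
  | n1.+1 => match n1 with
             | 0 => 'X *+ 2
             | n2.+1 => 'X *+ 2 * chebU n1 - chebU n2
             end
  end.

Lemma chebUSS n : chebU n.+2 = 'X *+ 2 * chebU n.+1 - chebU n.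
Proof. by []. Qed.

Lemma size_chebU n : (size (chebU n) <= n.+1)%N.
Proof.
have sX : (size ('X *+ 2 : {poly R}) <= 2)%N.
  by rewrite -scaler_nat (leq_trans (size_scale_leq _ _)) ?size_polyX.
suff : ((size (chebU n) <= n.+1) && (size (chebU n.+1) <= n.+2))%N by case/andP.
elim: n => [|n /andP[IH1 IH2]]; first by rewrite size_poly1.
apply/andP; split=> //; rewrite chebUSS.
apply: leq_trans (size_polyD _ _) _; rewrite geq_max size_polyN; apply/andP.
split; last exact: leq_trans IH1 (leqW (leqnSn _)).
apply: leq_trans (size_polyMleq _ _) _.
by move: (leq_add sX IH2); case: (_ + _)%N.
Qed.

Lemma sin_chebU n t : sin t * (chebU n).[cos t] = sin (n.+1%:R * t).
Proof.
suff : sin t * (chebU n).[cos t] = sin (n.+1%:R * t) /\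
       sin t * (chebU n.+1).[cos t] = sin (n.+2%:R * t) by case.
elim: n => [|n [IH1 IH2]].
  rewrite hornerC mulr1 mul1r /= hornerMn hornerX; split=> //.
  by rewrite mulr_natl sin_mulr2n mulrnAr mulrC.
split=> //; rewrite chebUSS hornerD hornerM hornerMn hornerX hornerN.
rewrite mulrBr mulrCA IH1 IH2.
have -> : n.+3%:R * t = n.+2%:R * t + t by rewrite -(natr1 n.+2) mulrDl mul1r.
have -> : n.+1%:R * t = n.+2%:R * t - t by rewrite -(natr1 n.+1) mulrDl mul1r addrK.
rewrite sinB sinD; ring.
Qed.

(** The Cauchy product of the expansions of (1 - t)^(-alpha) and of
    1 / (1 - 2 z t + t^2). *)
Definition genpoly (m : nat) : {poly R} :=
  \sum_(j < m.+1) binom_coef alpha j *: chebU (m - j).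

Lemma size_genpoly m : (size (genpoly m) <= m.+1)%N.
Proof.
apply: leq_trans (size_sum _ _ _) _; apply/bigmax_leqP => j _.
apply: leq_trans (size_scale_leq _ _) _.
by apply: leq_trans (size_chebU _) _; rewrite ltnS leq_subr.
Qed.

(** The recursion obtained by comparing coefficients in
    (1 - 2 z t + t^2) sum_m P_m t^m = (1 - t)^(-alpha); it identifies the
    convolution [genpoly] with the generated sequence. *)
Lemma genpolySS m :
  genpoly m.+2 = 'X *+ 2 * genpoly m.+1 - genpoly m + (binom_coef alpha m.+2)%:P.
Proof.
have E0 : genpoly m.+2 = \sum_(j < m.+1) binom_coef alpha j *: chebU (m.+2 - j) +
    binom_coef alpha m.+1 *: ('X *+ 2) + (binom_coef alpha m.+2)%:P.
  by rewrite /genpoly 2!big_ord_recr /= subnn subSn// subnn alg_polyC.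
have E1 : genpoly m.+1 = \sum_(j < m.+1) binom_coef alpha j *: chebU (m.+1 - j) +
    (binom_coef alpha m.+1)%:P.
  by rewrite /genpoly big_ord_recr /= subnn alg_polyC.
rewrite E0 E1; congr (_ + _).
rewrite mulrDr addrAC; congr (_ + _); last by rewrite mulrC mul_polyC.
rewrite mulr_sumr -sumrB; apply: eq_bigr => j _.
have le_jm : (j <= m)%N by rewrite -ltnS.
by rewrite !subSn ?(leqW le_jm)// chebUSS scalerBr scalerAr.
Qed.

(** The factor sin t converts each U_k into sin ((k + 1) t), and the factor
    2 sin (t / 2) converts that sine into a difference of two cosines at
    half-integer multiples of t, which makes summation by parts available. *)
Lemma genpoly_trig m t :
  2 * sin (t / 2) * (sin t * (genpoly m).[cos t]) =
  \sum_(j < m.+1) binom_coef alpha j *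
     (cos ((m.+1%:R + 2^-1) * t - j.+1%:R * t) -
      cos ((m.+1%:R + 2^-1) * t - j%:R * t)).
Proof.
rewrite /genpoly horner_sum mulr_sumr mulr_sumr; apply: eq_bigr => j _.
rewrite hornerZ [sin t * _]mulrCA sin_chebU mulrCA; congr (_ * _).
have le_jm : (j <= m)%N by rewrite -ltnS.
set s := (m - j).+1%:R * t.
have Es : s = m.+1%:R * t - j%:R * t by rewrite /s -subSn// natrB ?mulrBl// leqW.
have -> : (m.+1%:R + 2^-1) * t - j.+1%:R * t = s - t / 2.
  by rewrite Es -[j.+1%:R]natr1; field.
have -> : (m.+1%:R + 2^-1) * t - j%:R * t = s + t / 2 by rewrite Es; field.
rewrite cosB cosD; ring.
Qed.

Lemma cos_natpiB k (x : R) : cos (k%:R * pi - x) = (-1) ^+ k * cos x.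
Proof.
elim: k => [|k IH]; first by rewrite mul0r sub0r cosN expr0 mul1r.
by rewrite -natr1 mulrDl mul1r addrAC cosDpi IH exprS mulN1r mulNr.
Qed.

(** At these angles the reflection about k pi turns cos (w - j t) into
    (-1)^k cos (j t), so that all terms share the sign (-1)^k and the remaining
    sum is the positive one of [abel_sum_gt0] with e_j = 1 - cos (j t). *)
Lemma genpoly_sign m k t : 0 < alpha -> alpha < 1 ->
  0 < t < pi -> (m.+1%:R + 2^-1) * t = k%:R * pi ->
  0 < (-1) ^+ k.+1 * (genpoly m).[cos t].
Proof.
move=> a0 a1 /andP[t0 tpi] tk.
have s1 : 0 < sin t by rewrite sin_gt0_pi ?t0.
have s2 : 0 < sin (t / 2) by rewrite sin_gt0_pi//; lra.
have w0 : 0 < 2 * sin (t / 2) * sin t by rewrite !mulr_gt0.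
rewrite -(pmulr_rgt0 _ w0) mulrCA -[X in _ * X]mulrA genpoly_trig tk.
pose e j : R := 1 - cos (j%:R * t).
have := @abel_sum_gt0 _ (binom_coef alpha) e.
rewrite /e mul0r cos0 subrr mul1r subr_gt0 => /(_ _ _ erefl _ _ m).
rewrite mulr_sumr [X in _ -> 0 < X](_ : _ =
  \sum_(j < m.+1) binom_coef alpha j * (e j.+1 - e j)).
  apply.
  - by move=> j; exact: binom_coef_gt0.
  - by move=> j; exact: binom_coef_decr.
  - by rewrite -(cos0 R) ltr_cos ?in_itv/= ?lexx ?pi_ge0// !ltW.
  - by move=> j; rewrite subr_ge0 cos_le1.
apply: eq_bigr => j _; rewrite !cos_natpiB -mulrBr mulrCA; congr (_ * _).
by rewrite mulrA -exprD addSn addnn exprS -mul2n exprM sqrrN !expr1n /e; ring.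
Qed.

End Polynomials.

(** * Zeros from sign changes *)

Section Roots.
Variable R : realType.

(** The intermediate value theorem gives one zero in each interval; the next
    interval lies to the left of all earlier zeros, so they are distinct. *)
Lemma alternating_roots (p : {poly R}) (x : nat -> R) m :
    (forall k, (k < m)%N -> x k.+1 < x k) ->
    (forall k, (k <= m)%N -> 0 < (-1) ^+ k * p.[x k]) ->
  exists s : seq R, [/\ size s = m, uniq s, all (root p) s &
    all (fun r => x m < r < x 0%N) s].
Proof.
elim: m => [|m IH] x_decr sgn; first by exists [::].
have [||s [ss us rs bs]] := IH.
- by move=> k km; rewrite x_decr// ltnW.
- by move=> k km; rewrite sgn// leqW.
have xm0 : x m <= x 0%N.
  have : forall k, (k <= m)%N -> x k <= x 0%N.
    elim=> // k IHk km; apply: le_trans (IHk (ltnW km)).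
    by apply/ltW/x_decr/leqW.
  exact.
have [r rI rr] : {r | r \in `]x m.+1, x m[ & root p r}.
  apply: poly_ivtoo; first by rewrite ltW ?x_decr.
  have := mulr_gt0 (sgn m (leqnSn m)) (sgn m.+1 (leqnn _)).
  rewrite mulrACA -exprD addnS exprS addnn -mul2n exprM sqrrN !expr1n mulr1 mulN1r.
  by rewrite oppr_gt0 mulrC.
move: rI; rewrite in_itv/= => /andP[r1 r2].
exists (r :: s); split => /=.
- by rewrite ss.
- rewrite us andbT; apply/negP => /(allP bs) /andP[]; rewrite ltNge.
  by rewrite (ltW r2).
- by rewrite rr.
- rewrite r1 (lt_le_trans r2 xm0)/=.
  apply: sub_all bs => y /andP[y1 ->]; rewrite andbT.
  exact: lt_trans (x_decr _ _) y1.
Qed.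

(** The angles k pi / (m + 3/2) with 1 <= k <= m + 1 all lie in ]0, pi[, hence
    give m sign changes, as many as the degree allows. *)
Lemma genpoly_roots (alpha : R) m : 0 < alpha -> alpha < 1 ->
  genpoly alpha m != 0 /\
  exists s : seq R, [/\ size s = m, uniq s, all (root (genpoly alpha m)) s &
    all (fun r => -1 < r < 1) s].
Proof.
move=> a0 a1.
pose t k : R := k.+1%:R * pi / (m.+1%:R + 2^-1).
have d0 : 0 < m.+1%:R + 2^-1 :> R by rewrite addr_gt0.
have t_gt0 k : 0 < t k by rewrite divr_gt0 ?mulr_gt0 ?pi_gt0.
have t_ltpi k : (k <= m)%N -> t k < pi.
  move=> km; rewrite ltr_pdivrMr// mulrC ltr_pM2l ?pi_gt0//.
  by apply: le_lt_trans (_ : m.+1%:R < _); rewrite ?ler_nat// ltrDl.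
have tI k : (k <= m)%N -> t k \in `[0, pi].
  by move=> km; rewrite in_itv/= (ltW (t_gt0 k)) ltW ?t_ltpi.
have sgn k : (k <= m)%N -> 0 < (-1) ^+ k * (genpoly alpha m).[cos (t k)].
  move=> km; have := @genpoly_sign R alpha m k.+1 (t k) a0 a1.
  rewrite t_gt0 t_ltpi// => /(_ isT) H.
  have -> : (-1) ^+ k = (-1) ^+ k.+2 :> R by rewrite !exprS !mulN1r opprK.
  apply: H; by rewrite mulrC divfK// gt_eqF.
split.
  apply/negP => /eqP g0; have := sgn 0%N (leq0n _).
  by rewrite g0 horner0 mulr0 ltxx.
have [k km|//|s [ss us rs bs]] :=
    @alternating_roots (genpoly alpha m) (fun k => cos (t k)) m.
  rewrite ltr_cos ?tI ?(ltnW km)//.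
  by rewrite ltr_pM2r ?invr_gt0// ltr_pM2r ?pi_gt0// ltr_nat.
exists s; split=> //; apply: sub_all bs => r /andP[r1 r2].
by rewrite (le_lt_trans (cos_geN1 _) r1) (lt_le_trans r2 (cos_le1 _)).
Qed.

End Roots.

(** * Power series of a real variable *)

Section PowerSeries.
Variable R : realType.
Implicit Types (c : nat -> R) (x : R).

(** With y = sqrt x, each of the n + 1 powers y^0, ..., y^n is at least y^n, so
    (n + 1) y^n <= 1 / (1 - y), and a factor y^n is left to tend to 0. *)
Lemma cvg_natr_expr (x : R) : 0 <= x < 1 ->
  (fun n => n.+1%:R * x ^+ n) @ \oo --> (0 : R).
Proof.
move=> /andP[x0 x1]; pose y := Num.sqrt x.
have y0 : 0 <= y by exact: sqrtr_ge0.
have y1 : y < 1 by rewrite -sqrtr1 ltr_sqrt.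
have y1' : 0 < 1 - y by rewrite subr_gt0.
have xE : x = y ^+ 2 by rewrite sqr_sqrtr.
have up : (fun n => (1 - y)^-1 * y ^+ n) @ \oo --> (0 : R).
  rewrite -[X in _ --> X](mulr0 (1 - y)^-1); apply: cvgMr.
  by apply: cvg_expr; rewrite ger0_norm.
apply: squeeze_cvgr up; last exact: cvg_cst.
apply: nearW => n; rewrite mulr_ge0 ?exprn_ge0//=.
rewrite xE exprAC expr2 mulrA.
apply: ler_wpM2r; first exact: exprn_ge0.
rewrite -[leRHS]mulr1 ler_pdivlMl//.
apply: (@le_trans _ _ (1 - y ^+ n.+1)); last by rewrite gerBl exprn_ge0.
have := subrXX 1 y n.+1; rewrite expr1n => ->; rewrite ler_pM2l//.
under eq_bigr do rewrite expr1n mul1r.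
rewrite mulr_natl -[X in y ^+ n *+ X]card_ord -sumr_const.
apply: ler_sum => i _; rewrite ler_wiXn2l// ?ltW//.
by rewrite -ltnS.
Qed.

(** Fix y < r. For x = y e with e < 1, every partial sum differs from c_0 by at
    most e times the absolute sum at y, since its nonconstant terms contain a
    factor e; in the limit |c_0| is at most a multiple of e. *)
Lemma pseries0_coef0 c r : 0 < r ->
  (forall x, 0 < x < r -> pseries c x @ \oo --> (0 : R)) -> c 0%N = 0.
Proof.
move=> r0 c0; pose y := r / 3.
have y0 : 0 < y by rewrite divr_gt0.
have cvy : cvgn (pseries (fun i => `|c i|) y).
  apply: (@is_cvg_pseries_inside_norm _ _ (r / 2)).
    apply/cvg_ex; exists 0; apply: c0; lra.
  by rewrite !gtr0_norm ?divr_gt0// /y; lra.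
pose B := limn (pseries (fun i => `|c i|) y).
have leB n : pseries (fun i => `|c i|) y n <= B.
  apply: nondecreasing_cvgn_le => //; apply: nondecreasing_series => i _ _.
  by rewrite mulr_ge0// exprn_ge0// ltW.
have bnd e : 0 < e < 1 -> `|c 0%N| <= e * B.
  move=> /andP[e0 e1].
  have cve : pseries c (y * e) @ \oo --> (0 : R).
    by apply: c0; rewrite mulr_gt0//= /y; nra.
  have cve1 : (fun n => `|pseries c (y * e) n.+1 - c 0%N|) @ \oo --> `|0 - c 0%N|.
    apply: cvg_norm; apply: cvgB; last exact: cvg_cst.
    by move: cve; rewrite -cvg_shiftS.
  move: (cve1); rewrite sub0r normrN => /cvg_lim <- //.
  apply: limr_le; first by apply/cvg_ex; eexists; exact: cve1.
  near=> n.
  rewrite /pseries/= /series/= big_nat_recl// expr0 mulr1 [c 0%N + _]addrC addrK.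
  apply: le_trans (ler_norm_sum _ _ _) _.
  apply: (@le_trans _ _ (e * pseries (fun i => `|c i|) y n.+1)); last first.
    by rewrite ler_pM2l.
  rewrite /pseries/= /series/= big_nat_recl// mulrDr mulr_sumr.
  apply: (@le_trans _ _ (\sum_(0 <= i < n) e * (`|c i.+1| * y ^+ i.+1))); last first.
    by rewrite lerDr !mulr_ge0// ltW.
  apply: ler_sum => i _.
  rewrite normrM normrX (@gtr0_norm _ (y * e)) ?mulr_gt0// mulrCA.
  apply: ler_wpM2l => //; rewrite exprMn mulrC ler_pM2r ?exprn_gt0// exprS.
  by rewrite ler_piMr ?(ltW e0)// exprn_ile1// ltW.
(* Otherwise e = |c_0| / (2 B) would give |c_0| <= |c_0| / 2. *)
apply/eqP; rewrite -normr_le0 leNgt; apply/negP => cpos.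
have cB : `|c 0%N| <= B.
  by have := leB 1%N; rewrite /pseries/= /series/= big_nat1 expr0 mulr1.
have B0 : 0 < B by exact: lt_le_trans cB.
have e2 : `|c 0%N| / (2 * B) <= 1 / 2.
  by rewrite ler_pdivrMr ?mulr_gt0//; lra.
have := bnd (`|c 0%N| / (2 * B)).
rewrite divr_gt0 ?mulr_gt0//= => /(_ (le_lt_trans e2 _)).
have -> : `|c 0%N| / (2 * B) * B = `|c 0%N| / 2 by field; rewrite gt_eqF.
have /[swap]/[apply] : 1 / 2 < 1 :> R by lra.
by lra.
Unshelve. all: end_near. Qed.

(** Once c_0 = 0, division by x shows that the series with coefficients
    c_1, c_2, ... has sum 0 as well. *)
Lemma pseries0_coef c r : 0 < r ->
  (forall x, 0 < x < r -> pseries c x @ \oo --> (0 : R)) -> forall n, c n = 0.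
Proof.
move=> r0 + n; elim: n c => [|n IH] c c0; first exact: pseries0_coef0 c0.
have c00 := pseries0_coef0 r0 c0.
apply: (IH (fun i => c i.+1)) => x xr.
have x0 : x != 0 by case/andP: xr => x0 _; rewrite gt_eqF.
have -> : pseries (fun i => c i.+1) x = fun n => x^-1 * pseries c x n.+1.
  apply/funext => k; rewrite /pseries/= /series/= big_nat_recl// c00 mul0r add0r.
  rewrite mulr_sumr; apply: eq_bigr => i _.
  by rewrite mulrCA exprS mulKf.
rewrite -[X in _ --> X](mulr0 x^-1); apply: cvgMr.
by have := c0 _ xr; rewrite -cvg_shiftS.
Qed.

(** The coefficients of a power series multiplied by its variable. *)
Definition shift_coef c n := if n is k.+1 then c k else 0.

Lemma cvg_pseries_shift c x (l : R) :
  pseries c x @ \oo --> l -> pseries (shift_coef c) x @ \oo --> x * l.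
Proof.
move=> cl; rewrite -cvg_shiftS.
have -> : [sequence pseries (shift_coef c) x n.+1]_n = fun n => x * pseries c x n.
  apply/funext => k; rewrite /pseries/= /series/= big_nat_recl// mul0r add0r.
  by rewrite mulr_sumr; apply: eq_bigr => i _; rewrite exprS mulrCA.
exact: cvgMr.
Qed.

End PowerSeries.

(** * The binomial series with negative exponent *)

Section BinomialSeries.
Variables (R : realType) (alpha : R).
Hypotheses (alpha_gt0 : 0 < alpha) (alpha_lt1 : alpha < 1).

Definition binom_trunc n : {poly R} := \poly_(j < n) binom_coef alpha j.

Lemma binom_truncS n :
  binom_trunc n.+1 = binom_trunc n + binom_coef alpha n *: 'X^n.
Proof. by rewrite /binom_trunc !poly_def big_ord_recr. Qed.

(** The full series S satisfies (1 - c) S' = alpha S. For a partial sum the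
    differences telescope, so that a single monomial is missing. *)
Lemma binom_trunc_ode n c :
  (1 - c) * (binom_trunc n.+1)^`().[c] =
  alpha * (binom_trunc n.+1).[c] - n.+1%:R * binom_coef alpha n.+1 * c ^+ n.
Proof.
elim: n => [|n IH].
  rewrite binom_coefS binom_coef0 /binom_trunc poly_def big_ord1 binom_coef0.
  by rewrite scale1r expr0 derivC !hornerE; ring.
rewrite binom_truncS derivD derivZ derivXn /= !hornerE hornerMn !hornerXn.
rewrite mulrDr IH (binom_coefS alpha n.+1) -[c ^+ n *+ _]mulr_natl exprS.
by rewrite -[n.+1%:R in RHS]natr1 -[n.+1%:R in LHS]natr1; ring.
Qed.

(** With S a partial sum, [binom_trunc_ode] makes the derivative of
    S(y) (1 - y)^alpha equal to minus a monomial times (1 - y)^(alpha - 1). The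
    function is 1 at 0, and the mean value theorem on [0, x] gives the bound,
    since (1 - y)^(alpha - 1) <= 1 / (1 - x) there as alpha is positive. *)
Lemma binom_trunc_error n (x : R) : 0 <= x < 1 ->
  `|(binom_trunc n.+1).[x] * (1 - x) `^ alpha - 1| <= n.+1%:R * x ^+ n / (1 - x).
Proof.
move=> /andP[x0 x1].
pose g (y : R) := (binom_trunc n.+1).[y] * (1 - y) `^ alpha.
pose dg (y : R) : R :=
  - (n.+1%:R * binom_coef alpha n.+1 * y ^+ n) * (1 - y) `^ (alpha - 1).
have g_drv (y : R) : y < 1 -> is_derive y 1 g (dg y).
  move=> y1; have y1' : 0 < 1 - y by rewrite subr_gt0.
  have H1 : is_derive y 1 (fun y : R => 1 - y) (-1).
    by apply: is_derive_eq; rewrite add0r mul1r.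
  have H2 := @is_derive1_comp R (fun u => u `^ alpha) (fun y : R => 1 - y) y _ _
    (is_derive1_powR alpha y1') H1.
  apply: (is_derive_eq (is_deriveM (is_derive_poly (binom_trunc n.+1) y) H2)).
  rewrite /dg /GRing.scale/= -(mulr_powRB1 (ltW y1') alpha_gt0).
  have := binom_trunc_ode n y; set S' := (_^`()).[y]; set S := (_.[y]) => ode.
  transitivity ((1 - y) `^ (alpha - 1) * ((1 - y) * S' - alpha * S)); first by ring.
  by rewrite ode; ring.
have g0 : g 0 = 1.
  rewrite /g subr0 powR1 mulr1 horner_coef0 coef_poly /=; exact: binom_coef0.
have [||c] := @MVT_segment R g dg 0 x x0.
- by move=> y; rewrite in_itv/= => /andP[_ yx]; apply/g_drv/(lt_trans yx).
- apply: derivable_within_continuous => y; rewrite in_itv/= => /andP[_ yx].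
  by have [] := g_drv y (le_lt_trans yx x1).
rewrite in_itv/= => /andP[c0 cx]; rewrite g0 subr0 -/(g x) => ->.
have c1 : c < 1 := le_lt_trans cx x1.
have x1' : 0 < 1 - x by rewrite subr_gt0.
have pw : (1 - c) `^ (alpha - 1) <= (1 - x)^-1.
  apply: (@le_trans _ _ ((1 - c) `^ (- 1))).
    by apply: ger_powR; [rewrite subr_gt0 c1 gerBl|rewrite lerBrDr addNr ltW].
  rewrite powR_inv1 ?subr_ge0 ?(ltW c1)// lef_pV2 ?posrE ?subr_gt0//.
  by rewrite lerB.
have an : 0 <= binom_coef alpha n.+1 <= 1.
  by rewrite binom_coef_le1// ltW ?binom_coef_gt0.
have cn : 0 <= c ^+ n <= x ^+ n by rewrite exprn_ge0//= lerXn2r.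
rewrite /dg mulNr mulNr normrN ger0_norm; last first.
  by rewrite !mulr_ge0 ?powR_ge0//; [case/andP: an|case/andP: cn].
rewrite -[leRHS]mulr1; apply: ler_pM => //; last exact: ltW.
  by rewrite !mulr_ge0 ?powR_ge0//; [case/andP: an|case/andP: cn].
case/andP: an => a0 a1; case/andP: cn => cn0 cn1.
apply: ler_pM; rewrite ?mulr_ge0 ?powR_ge0//.
apply: ler_pM; rewrite ?mulr_ge0//.
by rewrite ler_piMr.
Qed.

Lemma binomial_series (x : R) : 0 <= x < 1 ->
  pseries (binom_coef alpha) x @ \oo --> ((1 - x) `^ alpha)^-1.
Proof.
move=> x01; have /andP[x0 x1] := x01.
have w0 : 0 < (1 - x) `^ alpha by apply: powR_gt0; rewrite subr_gt0.
rewrite -cvg_shiftS.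
have E n : pseries (binom_coef alpha) x n = (binom_trunc n).[x].
  rewrite /binom_trunc poly_def horner_sum /pseries/= /series/= big_mkord.
  by apply: eq_bigr => i _; rewrite !hornerE.
have -> : [sequence pseries (binom_coef alpha) x n.+1]_n = fun n =>
    ((1 - x) `^ alpha)^-1 * (((binom_trunc n.+1).[x] * (1 - x) `^ alpha - 1) + 1).
  by apply/funext => n /=; rewrite E subrK mulrC mulfK// gt_eqF.
rewrite -[_^-1 in X in _ --> X]mulr1; apply: cvgMr.
rewrite -[X in _ --> X](add0r (1 : R)); apply: cvgD; last exact: cvg_cst.
apply: norm_cvg0.
have up : (fun n => (1 - x)^-1 * (n.+1%:R * x ^+ n)) @ \oo --> (0 : R).
  by rewrite -[X in _ --> X](mulr0 (1 - x)^-1); apply: cvgMr; exact: cvg_natr_expr.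
apply: squeeze_cvgr up; last exact: cvg_cst.
apply: nearW => n; rewrite normr_ge0/= [_^-1 * _]mulrC.
exact: binom_trunc_error.
Qed.

End BinomialSeries.

(** * Expansion of the generating function *)

Section Identification.
Variables (R : realType) (alpha : R).
Hypotheses (alpha_gt0 : 0 < alpha) (alpha_lt1 : alpha < 1).

(** Multiplying by 1 - 2 z x + x^2 amounts to combining shifts of the
    coefficient sequence; the result sums to (1 - x)^(-alpha), hence is the
    binomial sequence, which is the recursion of [genpolySS]. *)
Lemma genpoly_unique (p : nat -> R) (z r : R) : 0 < r ->
    (forall x, 0 < x < r ->
      pseries p x @ \oo --> ((1 - x) `^ alpha * (1 - 2 * z * x + x ^+ 2))^-1) ->
  forall m, p m = (genpoly alpha m).[z].
Proof.
move=> r0 pF.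
pose q m := p m - 2 * z * shift_coef p m + shift_coef (shift_coef p) m.
have qE m : q m = binom_coef alpha m.
  apply/eqP; rewrite -subr_eq0; apply/eqP; move: m.
  (* Below this radius 2 |z| x < 1 - 2 x, which keeps 1 - 2 z x + x^2 positive
     and x < 1. *)
  pose s := Num.min r (2 * (`|z| + 1))^-1.
  have z1 : 0 < `|z| + 1 by rewrite ltr_wpDl.
  have s0 : 0 < s by rewrite lt_min r0 invr_gt0 mulr_gt0.
  apply: (pseries0_coef (c := fun m => q m - binom_coef alpha m) s0) => x.
  rewrite lt_min => /andP[x0 /andP[xr xz]].
  have xz1 : 2 * (`|z| + 1) * x < 1.
    by rewrite mulrC -ltr_pdivlMr ?mulr_gt0// mul1r.
  have zx : z * x <= `|z| * x by rewrite ler_pM2r// ler_norm.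
  have zx0 : 0 <= `|z| * x by rewrite mulr_ge0// ltW.
  have x1 : 0 <= x < 1 by rewrite ltW//=; nra.
  have D0 : 1 - 2 * z * x + x ^+ 2 != 0 by rewrite gt_eqF//; nra.
  have := pF x; rewrite x0 xr => /(_ isT).
  set F := _^-1 => pl.
  have sl := cvg_pseries_shift pl; have ssl := cvg_pseries_shift sl.
  have -> : pseries (fun m => q m - binom_coef alpha m) x = fun n =>
      pseries p x n - 2 * z * pseries (shift_coef p) x n +
      pseries (shift_coef (shift_coef p)) x n - pseries (binom_coef alpha) x n.
    apply/funext => n; rewrite /pseries/= /series/= mulr_sumr -sumrB -big_split/=.
    by rewrite -sumrB; apply: eq_bigr => i _; rewrite /q; ring.
  have -> : (0 : R) = F - 2 * z * (x * F) + x * (x * F) - ((1 - x) `^ alpha)^-1.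
    have w0 : (1 - x) `^ alpha != 0.
      by rewrite gt_eqF// powR_gt0// subr_gt0; case/andP: x1.
    have -> : ((1 - x) `^ alpha)^-1 = (1 - 2 * z * x + x ^+ 2) * F.
      by rewrite /F invfM mulrCA mulfV// mulr1.
    by ring.
  apply: cvgB; last exact: binomial_series.
  by apply: cvgD => //; apply: cvgB => //; apply: cvgMr.
suff H m : p m = (genpoly alpha m).[z] /\ p m.+1 = (genpoly alpha m.+1).[z].
  by move=> m; have [] := H m.
elim: m => [|m [IH1 IH2]].
  have g0 : genpoly alpha 0 = 1.
    by rewrite /genpoly big_ord1 binom_coef0 scale1r.
  have g1 : genpoly alpha 1 = 'X *+ 2 + (binom_coef alpha 1)%:P.
    by rewrite /genpoly big_ord_recr big_ord1/= binom_coef0 scale1r alg_polyC.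
  have p0 : p 0%N = 1.
    by have := qE 0%N; rewrite /q/= binom_coef0 mulr0 subr0 addr0.
  rewrite g0 g1 hornerD hornerMn hornerX !hornerC p0; split=> //.
  by rewrite -(qE 1%N) /q/= p0; ring.
split=> //; rewrite genpolySS !hornerD hornerN hornerM hornerMn hornerX hornerC.
by rewrite -IH1 -IH2 -(qE m.+2) /q/=; ring.
Qed.

End Identification.

(** * From complex to real power series *)

Section ComplexToReal.
Variable R : realType.
Local Open Scope complex_scope.

Lemma cpow_real (x a : R) : 0 < x -> cpow x%:C a = (x `^ a)%:C.
Proof.
move=> x0; rewrite /cpow /carg /cmod /= lexx expr0n/= addr0 sqrtr_sqr.
by rewrite gtr0_norm// divff ?gt_eqF// acos1 mulr0 cos0 sin0 mulr1.
Qed.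

Lemma cvg_Re (u : nat -> R[i]) (l : R[i]) : (u : nat -> R[i]^o) @ \oo --> (l : R[i]^o) ->
  (fun n => complex.Re (u n)) @ \oo --> complex.Re l.
Proof.
move=> /cvgrPdist_lt ul; apply/cvgrPdist_lt => e e0.
have e0' : 0 < e%:C by rewrite ltcR.
apply: filterS (ul _ e0') => n; rewrite -ltcR; apply: le_lt_trans.
have -> : complex.Re l - complex.Re (u n) = complex.Re (l - u n).
  by case: (l); case: (u n).
exact: normc_ge_Re.
Qed.

Lemma cvg_Im (u : nat -> R[i]) (l : R[i]) : (u : nat -> R[i]^o) @ \oo --> (l : R[i]^o) ->
  (fun n => complex.Im (u n)) @ \oo --> complex.Im l.
Proof.
move=> /cvgrPdist_lt ul; apply/cvgrPdist_lt => e e0.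
have e0' : 0 < e%:C by rewrite ltcR.
apply: filterS (ul _ e0') => n; rewrite -ltcR; apply: le_lt_trans.
have -> : complex.Im l - complex.Im (u n) = complex.Im (l - u n).
  by case: (l); case: (u n).
by rewrite normc_def lecR -sqrtr_sqr ler_wsqrtr// lerDr sqr_ge0.
Qed.

(** On the positive real axis near 0 the principal argument of 1 - x is 0, so
    that the complex limit is a real number. *)
Lemma generated_real (P : nat -> {poly R[i]}) (a z : R) :
  generated_by P a -> exists2 r : R, 0 < r & forall x, 0 < x < r ->
    series (fun m => (P m).[z%:C] * x%:C ^+ m : R[i]^o) @ \oo -->
      ((((1 - x) `^ a * (1 - 2 * z * x + x ^+ 2))^-1)%:C : R[i]^o).
Proof.
move=> /(_ z%:C) /nbhs_ballP[e /= e0 He].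
have eE : e = (complex.Re e)%:C.
  by case: e e0 {He} => re im; rewrite ltcE/= => /andP[/eqP-> _].
have re0 : 0 < complex.Re e by rewrite -ltcR -eE.
exists (Num.min 1 (complex.Re e)); first by rewrite lt_min ltr01.
move=> x; rewrite lt_min => /andP[x0 /andP[x1 xe]].
have := He x%:C; rewrite -ball_normE /ball_/= sub0r normrN.
rewrite (_ : `|x%:C| = x%:C); last by rewrite ger0_norm// lecR ltW.
rewrite eE ltcR => /(_ xe).
have -> : 1 - x%:C = (1 - x)%:C by rewrite rmorphB rmorph1.
have /(cpow_real a) -> : 0 < 1 - x by rewrite subr_gt0.
suff -> : 1 / (((1 - x) `^ a)%:C * (1 - 2 * z%:C * x%:C + x%:C ^+ 2)) =
   (((1 - x) `^ a * (1 - 2 * z * x + x ^+ 2))^-1)%:C by [].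
by rewrite div1r fmorphV rmorphM rmorphD rmorphB rmorphXn !rmorphM rmorph1 rmorph_nat.
Qed.

(** At a real z the imaginary parts of the coefficients form a power series
    with sum 0 and the real parts one with the prescribed real sum; real points
    suffice to determine the polynomial. *)
Lemma generated_genpoly (P : nat -> {poly R[i]}) (a : R) :
    0 < a -> a < 1 -> generated_by P a ->
  forall m, P m = map_poly (real_complex R) (genpoly a m).
Proof.
move=> a0 a1 genP m.
have Pz (z : R) : (P m).[z%:C] = (genpoly a m).[z]%:C.
  have [r r0 Hr] := generated_real z genP.
  have SE x n : series (fun m => (P m).[z%:C] * x%:C ^+ m : R[i]^o) n =
      pseries (fun m => complex.Re (P m).[z%:C]) x n +i*
      pseries (fun m => complex.Im (P m).[z%:C]) x n.
    rewrite /pseries/= /series/=; elim: n => [|n IH]; first by rewrite !big_nil.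
    rewrite !big_nat_recr//= IH -rmorphXn.
    by case: (_.[_]) => u v; simpc.
  have ReP : complex.Re (P m).[z%:C] = (genpoly a m).[z].
    apply: (genpoly_unique a0 a1 (p := fun m => complex.Re (P m).[z%:C]) r0) => x xr.
    have /cvg_Re := Hr x xr.
    by under eq_fun do rewrite SE.
  have ImP : complex.Im (P m).[z%:C] = 0.
    apply: (pseries0_coef (c := fun m => complex.Im (P m).[z%:C]) r0) => x xr.
    by have /cvg_Im := Hr x xr; under eq_fun do rewrite SE.
  by rewrite -ReP; case: (_.[_]) ImP => u v /= ->.
apply/eqP; rewrite -subr_eq0; apply/eqP.
set d := _ - _; pose rs : seq R[i] := [seq (i%:R : R)%:C | i <- iota 0 (size d)].
apply: (@roots_geq_poly_eq0 _ d rs).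
- apply/allP => _ /mapP[i _ ->]; rewrite rootE /d hornerD hornerN Pz.
  by rewrite (horner_map (real_complex R)) subrr.
- rewrite map_inj_uniq ?iota_uniq// => i j /complexI /eqP.
  by rewrite eqr_nat => /eqP.
- by rewrite size_map size_iota.
Qed.

End ComplexToReal.

(** * Zeros of the generated polynomials *)

Theorem theorem1 (R : realType) (alpha : R) (P : nat -> {poly R[i]})
    (alpha_gt0 : 0 < alpha) (alpha_lt1 : alpha < 1)
    (genP : generated_by P alpha) :
  exists C : nat, forall m : nat,
    at_most_zeros_in (~` real_interval (-1) 1) (P m) C.
Proof.
exists 0%N => m.
rewrite (generated_genpoly alpha_gt0 alpha_lt1 genP m).
have [Q0 [s [ss us rs bs]]] := genpoly_roots m alpha_gt0 alpha_lt1.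
split; first by rewrite map_poly_eq0.
rewrite leqn0 fsbig1// => w w_out; apply: mupNroot.
(* A further root w would give m + 1 distinct roots in degree at most m. *)
apply: contra Q0 => rw; rewrite -(map_poly_eq0 (real_complex R)).
apply/eqP/(@roots_geq_poly_eq0 _ _ (w :: [seq real_complex R r | r <- s])) => /=.
- rewrite rw all_map; apply: sub_all rs => r /=.
  by rewrite fmorph_root.
- rewrite map_inj_uniq ?us ?andbT; last exact: complexI.
  by apply/mapP => -[r /(allP bs) r_in wr]; apply: w_out; exists r.
- by rewrite size_map size_map_poly ss size_genpoly.
Qed.
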